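(* Let $|q|<1$, let $k\geq 1$ be an integer, let $a_1,\dots,a_k$, $b_1,\dots,b_k$, $c_1,\dots,c_k$ be complex numbers, and let $\{g(j)\}_{j=0}^{\infty}$ be a sequence of complex numbers such that both series below converge. Let the sum on the left be over all integer $(k+1)$-tuples $\vec{m}=(m_1,m_2,\dots,m_{k+1})$ with $m_1\geq m_2\geq\dots\geq m_k\geq m_{k+1}\geq 0$. Then \[ \sum_{\vec{m}}\prod_{j=1}^{k}\frac{(a_j;q)_{m_j}(c_j/b_j;q)_{m_{j+1}}(b_j;q)_{m_j-m_{j+1}}}{(c_j;q)_{m_j}(a_j;q)_{m_{j+1}}(q;q)_{m_j-m_{j+1}}}\left(\frac{c_j}{a_jb_j}\right)^{m_j-m_{j+1}} g(m_{k+1}) =\prod_{j=1}^{k}\frac{(c_j/a_j,c_j/b_j;q)_{\infty}}{(c_j,c_j/a_jb_j;q)_{\infty}}\sum_{j=0}^{\infty}g(j). \]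
   Context: Notation: $(x;q)_n=(1-x)(1-xq)\cdots(1-xq^{n-1})$ for integers $n\ge 0$ (with $(x;q)_0=1$), $(x;q)_\infty=\prod_{i\ge0}(1-xq^i)$, and $(x_1,\dots,x_r;q)_n=(x_1;q)_n\cdots(x_r;q)_n$ (similarly for $n=\infty$). The parameters are assumed such that no denominator vanishes. *)

(* Defs.v *)
(* MathComp / MathComp-Analysis world. *)
From HB Require Import structures.
From mathcomp Require Import all_boot all_order all_algebra.
From mathcomp Require Import finmap complex.
From mathcomp Require Import all_classical all_reals all_analysis.
(* [summability] is not imported: its [sum] would shadow the sum type. *)
From mathcomp Require summability.

Set Implicit Arguments.
Unset Strict Implicit.
Unset Printing Implicit Defensive.

Import Order.TTheory GRing.Theory Num.Theory.
Import numFieldNormedType.Exports.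

Local Open Scope classical_set_scope.
Local Open Scope ring_scope.

(* The definitions are over an arbitrary [numFieldType] K, whose canonical
   topology is that of its norm; they are meant for K = R[i], R : realType. *)

Definition qpoch (K : numFieldType) (q x : K) (n : nat) : K :=
  \prod_(i < n) (1 - x * q ^+ i).

(* Only meaningful when the partial products converge, e.g. for |q| < 1. *)
Definition qpoch_inf (K : numFieldType) (q x : K) : K := limn (qpoch q x).

(* (m_1, ..., m_(k+1)) with m_1 >= ... >= m_(k+1) >= 0; positions are counted
   from 0, so that m_j is [nth 0 m j.-1]. *)
Definition noninc_tuple (k : nat) := {m : k.+1.-tuple nat | sorted geq m}.

Definition mpart (k : nat) (m : noninc_tuple k) (i : nat) : nat :=
  nth 0%N (val m) i.

(* A multiple series over a countable index type I is an unordered sum: its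
   value is the limit of the finite partial sums along the finite subsets of I
   directed by inclusion.  Over R[i], this converges iff it does so absolutely. *)
Definition multiseries_cvg (I : choiceType) (K : numFieldType) (f : I -> K) :=
  cvg (summability.partial_sum f @ summability.totally).

Definition multiseries_sum (I : choiceType) (K : numFieldType) (f : I -> K) : K :=
  summability.sum f.

(* The index j : 'I_k stands for j + 1 in the usual numbering 1, ..., k. *)
Definition multisum_term (K : numFieldType) (k : nat) (q : K)
    (a b c : 'I_k -> K) (g : nat -> K) (m : noninc_tuple k) : K :=
  (\prod_(j < k)
     ((qpoch q (a j) (mpart m j)
       * qpoch q (c j / b j) (mpart m j.+1)
       * qpoch q (b j) (mpart m j - mpart m j.+1))
      / (qpoch q (c j) (mpart m j)
         * qpoch q (a j) (mpart m j.+1)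
         * qpoch q q (mpart m j - mpart m j.+1))
      * (c j / (a j * b j)) ^+ (mpart m j - mpart m j.+1)))
  * g (mpart m k).

(* Main.v *)
Require Import Defs.
From HB Require Import structures.
From mathcomp Require Import all_boot all_order all_algebra.
From mathcomp Require Import finmap complex.
From mathcomp Require Import all_classical all_reals all_analysis.
From mathcomp Require Import ring zify.
Import Order.TTheory GRing.Theory Num.Theory.
Import numFieldNormedType.Exports.
Local Open Scope classical_set_scope.
Local Open Scope ring_scope.

(* Summing over m_1 with (m_2, ..., m_(k+1)) fixed is a q-Gauss summation

     sum_n (a)_n (b)_n / ((c)_n (q)_n) z^n
       = (c/a)_oo (c/b)_oo / ((c)_oo (z)_oo),   z = c / (a b),

   with a and c shifted by q^(m_2); it yields the constant j = 1 factor of the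
   product times the summand of the (k-1)-fold series, and one iterates (if the
   constant vanishes, both sides are 0).

   Since |z| may be >= 1, q-Gauss is proved from a contiguous relation
   (c, z) -> (c q, z q) between partial sums.  It telescopes, with a boundary
   term proportional to the N-th term of the series, so it is enough that the
   terms tend to 0, which unordered convergence of the multiple series gives.
   Iterating the relation m times turns z into z q^m, and the q-Gauss series
   tends to 1 as m grows. *)

(** * Complex sequences and convergence of the infinite q-product *)

Lemma normcE_complex {R : realType} (z : R[i]) :
  `|z| = (ComplexField.Normc.normc z)%:C%C.
Proof. by case: z => x y; rewrite normc_def. Qed.

Lemma cvg_complex {R : realType} (u : nat -> R[i]^o) :
  cvgn (fun n => complex.Re (u n) : R^o) ->
  cvgn (fun n => complex.Im (u n) : R^o) ->
  cvgn u.
Proof.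
move=> /cvg_ex[/= x ux] /cvg_ex[/= y uy].
apply/cvg_ex; exists ((x +i* y)%C : R[i]^o); apply/cvgrPdist_lt => eps eps0.
(* A positive element of [R[i]] is real, so the estimate can be made in [R] with [Re eps]. *)
have epsE : eps = (complex.Re eps)%:C%C by rewrite RRe_real// realE ltW.
have e0 : 0 < complex.Re eps / 2.
  by rewrite divr_gt0//; move: eps0; rewrite ltcE => /andP[].
have /cvgrPdist_lt/(_ _ e0) Hx := ux; have /cvgrPdist_lt/(_ _ e0) Hy := uy.
near=> n.
have -> : (x +i* y)%C - u n
    = (x - complex.Re (u n))%:C%C + 'i%C * (y - complex.Im (u n))%:C%C.
  by case: (u n) => p r; simpc.
apply: le_lt_trans (ler_normD _ _) _; rewrite normrM !normc_def /=.
rewrite !expr0n/= !addr0 expr1n add0r !sqrtr_sqr sqrtr1 mul1r -rmorphD/= epsE ltcR.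
rewrite [ltRHS]splitr ltrD//.
- by near: n.
- by near: n.
Unshelve. all: by end_near. Qed.

Lemma cvg_complex_expr {R : realType} (q : R[i]) :
  `|q| < 1 -> (fun n => q ^+ n : R[i]^o) @ \oo --> (0 : R[i]^o).
Proof.
rewrite normcE_complex => q1; set r := ComplexField.Normc.normc q in q1.
have r1 : `|r| < 1.
  move: q1; rewrite -[1]/(1%:C%C) ltcR => q1.
  by rewrite ger0_norm// /r; case: (q) => x y; rewrite sqrtr_ge0.
apply/cvgr0Pnorm_lt => eps eps0.
have epsE : eps = (complex.Re eps)%:C%C by rewrite RRe_real// realE ltW.
have e0 : 0 < complex.Re eps by move: eps0; rewrite ltcE => /andP[].
have /cvgr0Pnorm_lt/(_ _ e0) H := cvg_expr r1.
near=> n.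
rewrite normrX normcE_complex -/r -rmorphXn/= epsE ltcR.
by apply: le_lt_trans (ler_norm _) _; near: n.
Unshelve. all: by end_near. Qed.

(** The partial products are bounded, so their successive differences are dominated by a geometric
    sequence. Series comparison lives in [R] and is applied to real and imaginary parts. *)
Lemma is_cvg_qpoch {R : realType} (q x : R[i]) :
  `|q| < 1 -> cvgn (qpoch q x : nat -> R[i]^o).
Proof.
set N := @ComplexField.Normc.normc R.
rewrite normcE_complex -[1]/(1%:C%C) ltcR -/N => q1.
have N0 (z : R[i]) : 0 <= N z by rewrite /N; case: z => ? ?; rewrite sqrtr_ge0.
have NX (z : R[i]) n : N (z ^+ n) = N z ^+ n.
  by apply: complexI; rewrite rmorphXn/= -!normcE_complex normrX.
set B := expR (N x / (1 - N q)).
have geomE n : \sum_(i < n) N x * N q ^+ i <= N x / (1 - N q).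
  rewrite -mulr_sumr ler_wpM2l// -subr_ge0.
  have := subrX1 (N q) n; set S := \sum_(i < n) _ => E.
  have q1' : 0 < 1 - N q by rewrite subr_gt0.
  have -> : (1 - N q)^-1 - S = N q ^+ n / (1 - N q).
    apply: (mulIf (lt0r_neq0 q1')); rewrite mulrBl mulVf ?divfK ?lt0r_neq0//.
    by rewrite -[N q ^+ n](subrK 1) E; ring.
  exact: divr_ge0 (exprn_ge0 _ (N0 q)) (ltW q1').
(* Each factor satisfies [N (1 - u) <= 1 + N u <= expR (N u)]; the exponents sum to at most
   [N x / (1 - N q)]. *)
have bnd n : N (qpoch q x n) <= B.
  apply: (@le_trans _ _ (expR (\sum_(i < n) N x * N q ^+ i))); last first.
    by rewrite ler_expR.
  rewrite expR_sum /qpoch.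
  elim/big_ind2: _ => [|a b c d ab cd|i _].
  - by rewrite /N ComplexField.Normc.normc1.
  - by rewrite /N ComplexField.Normc.normcM ler_pM.
  - apply: le_trans (expR_ge1Dx _); apply: le_trans (le_normcD _ _) _.
    by rewrite normcN ComplexField.Normc.normc1 ComplexField.Normc.normcM -!/(N _) NX.
(* Telescoping: the step from [i] to [i.+1] adds [- x q^i (x;q)_i]. *)
have dE n : qpoch q x n = 1 + \sum_(0 <= i < n) - (x * q ^+ i * qpoch q x i).
  elim: n => [|n IH]; first by rewrite /qpoch big_ord0 big_geq// addr0.
  rewrite big_nat_recr//= addrA -IH /qpoch big_ord_recr/=; ring.
have dom n : N (- (x * q ^+ n * qpoch q x n)) <= geometric (N x * B) (N q) n.
  rewrite /geometric/= /N normcN !ComplexField.Normc.normcM.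
  by rewrite -!/(N _) NX mulrAC ler_wpM2r ?exprn_ge0// ler_wpM2l.
have conv (f : nat -> R) : (forall n, `|f n| <= N (- (x * q ^+ n * qpoch q x n))) ->
    cvgn (series (f : nat -> R^o)).
  move=> fN; apply: normed_cvg.
  apply: (@series_le_cvg _ _ (geometric (N x * B) (N q))) => //.
  - by move=> n /=.
  - by move=> n; rewrite /geometric/= !mulr_ge0 ?exprn_ge0// expR_ge0.
  - by move=> n; exact: le_trans (fN n) (dom n).
  - by apply: is_cvg_geometric_series; rewrite ger0_norm.
apply: cvg_complex.
- rewrite (_ : (fun n => _) = fun n => 1 +
     series ((fun n => complex.Re (- (x * q ^+ n * qpoch q x n))) : nat -> R^o) n).
    apply: is_cvgD; first exact: is_cvg_cst.
    apply: conv => n; rewrite -lecR -normcE_complex; exact: normc_ge_Re.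
  apply/funext => n; rewrite dE raddfD/= /series/=.
  by rewrite (raddf_sum (@complex.Re R : Rcomplex R -> R)).
- rewrite (_ : (fun n => _) = fun n =>
     series ((fun n => complex.Im (- (x * q ^+ n * qpoch q x n))) : nat -> R^o) n).
    apply: conv => n; rewrite -lecR -normcE_complex.
    case: (- _) => p r; rewrite /= normc_def/= lecR -sqrtr_sqr ler_wsqrtr//.
    by rewrite lerDr sqr_ge0.
  apply/funext => n; rewrite dE raddfD/= add0r /series/=.
  by rewrite (raddf_sum (@complex.Im R : Rcomplex R -> R)).
Qed.

(** * Algebra of finite q-Pochhammer symbols *)

Lemma qpochD {K : numFieldType} (q x : K) (m n : nat) :
  qpoch q x (m + n) = qpoch q x m * qpoch q (x * q ^+ m) n.
Proof.
rewrite /qpoch big_split_ord/=; congr (_ * _).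
by apply: eq_bigr => i _; rewrite -mulrA -exprD.
Qed.

Lemma qpochS {K : numFieldType} (q x : K) (n : nat) :
  qpoch q x n.+1 = qpoch q x n * (1 - x * q ^+ n).
Proof. by rewrite /qpoch big_ord_recr. Qed.

Lemma qpoch_shift_neq0 {K : numFieldType} (q x : K) (m : nat) :
  (forall n, qpoch q x n != 0) -> forall n, qpoch q (x * q ^+ m) n != 0.
Proof.
by move=> x0 n; have := x0 (m + n)%N; rewrite qpochD mulf_eq0 negb_or => /andP[].
Qed.

Lemma qpoch_qq_neq0 {K : numFieldType} (q : K) (n : nat) :
  `|q| < 1 -> qpoch q q n != 0.
Proof.
move=> q1; apply/prodf_neq0 => i _; rewrite subr_eq0 -exprS.
apply: contraTneq q1 => q1E.
have := congr1 Num.norm q1E; rewrite normr1 normrX => /esym/eqP.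
by rewrite -[_ < _]negbK; apply: contraTN => /negbNE q1; rewrite lt_eqF// exprn_ilt1.
Qed.

(** * The basic hypergeometric series 2phi1(a, b; c; q, z) and its q-Gauss sum *)

Definition phi_term {K : numFieldType} (q a b c z : K) (n : nat) : K :=
  (qpoch q a n * qpoch q b n) / (qpoch q c n * qpoch q q n) * z ^+ n.

Lemma phi_termS {K : numFieldType} (q a b c z : K) (n : nat) :
  phi_term q a b c z n.+1 = phi_term q a b c z n *
    ((1 - a * q ^+ n) * (1 - b * q ^+ n) / ((1 - c * q ^+ n) * (1 - q ^+ n.+1)) * z).
Proof. by rewrite /phi_term !qpochS !exprS !invfM; ring. Qed.

Lemma phi_term_shift {K : numFieldType} (q a b c z : K) (m n : nat) :
  (forall i, qpoch q c i != 0) ->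
  phi_term q a b (c * q ^+ m) (z * q ^+ m) n
  = phi_term q a b c z n
    * (q ^+ (n * m) * (qpoch q c n * qpoch q c m / qpoch q c (n + m))).
Proof.
move=> c0; have := c0 (m + n)%N; rewrite qpochD mulf_eq0 negb_or => /andP[_ cm0].
rewrite /phi_term addnC qpochD exprMn -exprM mulnC !invfM.
have := c0 n; have := c0 m => {c0}.
move: (qpoch q c m) (qpoch q c n) (qpoch q _ n) cm0 (qpoch q q n)^-1
  => x y w w0 v x0 y0.
by field; rewrite x0 y0 w0.
Qed.

(* Wilf-Zeilberger telescoping with certificate (q^n - 1) (1 - c). *)
Lemma phi_sum_contiguous {K : numFieldType} (q a b c z : K) (n : nat) :
  `|q| < 1 -> (forall i, qpoch q c i != 0) -> c = z * a * b ->
  (1 - c) * (1 - z) * (\sum_(0 <= i < n) phi_term q a b c z i)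
  - (1 - z * a) * (1 - z * b)
    * (\sum_(0 <= i < n) phi_term q a b (c * q) (z * q) i)
  = - ((1 - c) * (1 - q ^+ n) * phi_term q a b c z n).
Proof.
move=> q1 c0 cE; elim: n => [|n IH]; first by rewrite !big_geq// expr0; ring.
rewrite !big_nat_recr//= (mulrDr ((1 - c) * _)) (mulrDr ((1 - z * a) * _)).
rewrite opprD addrACA IH {IH} phi_termS.
have := phi_term_shift q a b c z 1 n c0; rewrite !expr1 muln1 addn1 => ->.
have := c0 n.+1; rewrite qpochS mulf_eq0 negb_or => /andP[cn0 cq0].
have := qpoch_qq_neq0 q n.+1 q1; rewrite qpochS mulf_eq0 negb_or => /andP[_ qq0].
rewrite /qpoch !big_ord_recr !big_ord0/= expr0 mul1r mulr1 -/(qpoch q c n).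
move: (phi_term _ _ _ _ _ _) cn0 cq0 qq0 => t cn0.
rewrite !exprS; move: (q ^+ n) => Q cq0 qq0; move: (qpoch q c n) cn0 => y y0.
by subst c; field; rewrite qq0 cq0 y0.
Qed.

Lemma cvg_norm_le {K : numFieldType} (u : nat -> K) (l : K) :
  u @ \oo --> l -> exists B, forall n, `|u n| <= B.
Proof.
move=> ul; have b := (@cvg_seq_bounded K K^o u (cvgP _ ul)).
have F : ProperFilter (globally [set: nat]) by exact: (@globally_properfilter _ _ 0%N).
by have [B HB] := (@ex_bound _ _ _ u _ F).1 b; exists B => n; exact: HB.
Qed.

(** Since [(c;q)_n] tends to a nonzero limit, it and its inverse are bounded, hence so is the factor
    [(c)_n (c)_m / (c)_(n+m)] of [phi_term_shift], uniformly in [m] and [n]. *)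
Lemma phi_term_shift_bound {K : numFieldType} (q a b c z l : K) :
  `|q| < 1 -> (forall n, qpoch q c n != 0) ->
  qpoch q c @ \oo --> l -> l != 0 ->
  exists2 B : K, 0 <= B & forall m n,
    `|phi_term q a b (c * q ^+ m) (z * q ^+ m) n|
    <= B * `|phi_term q a b c z n| * `|q| ^+ (n * m).
Proof.
move=> q1 c0 cl l0.
have [B1 cB1] : exists B, forall n, `|qpoch q c n| <= B.
  exact: cvg_norm_le cl.
have [B2 cB2] : exists B, forall n, `|(qpoch q c n)^-1| <= B.
  exact: cvg_norm_le (cvgV l0 cl).
have B10 : 0 <= B1 := le_trans (normr_ge0 _) (cB1 0%N).
have B20 : 0 <= B2 := le_trans (normr_ge0 _) (cB2 0%N).
exists (B1 * B1 * B2) => [|m n]; first by rewrite !mulr_ge0.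
rewrite phi_term_shift//; move: (phi_term q a b c z n) => t.
rewrite !normrM normrX.
have -> : B1 * B1 * B2 * `|t| * `|q| ^+ (n * m)
    = `|t| * (`|q| ^+ (n * m) * (B1 * B1 * B2)) by ring.
by rewrite !ler_wpM2l ?exprn_ge0// !ler_pM ?mulr_ge0.
Qed.

Lemma phi_term_shift_cvg0 {K : numFieldType} (q a b c z l : K) (m : nat) :
  `|q| < 1 -> (forall n, qpoch q c n != 0) ->
  qpoch q c @ \oo --> l -> l != 0 ->
  phi_term q a b c z @ \oo --> (0 : K) ->
  phi_term q a b (c * q ^+ m) (z * q ^+ m) @ \oo --> (0 : K).
Proof.
move=> q1 c0 cl l0 t0; have [B B0 tB] := phi_term_shift_bound q a b c z l q1 c0 cl l0.
have Bt0 : (fun n => B * `|phi_term q a b c z n|) @ \oo --> (0 : K).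
  rewrite -(mulr0 B) -[X in B * X](@normr0 K K); apply: cvgM; first exact: cvg_cst.
  exact: cvg_norm.
apply/cvgr0Pnorm_le => e e0.
have /cvgr0Pnorm_le/(_ _ e0) H := Bt0.
near=> n; apply: le_trans (tB m n) _.
apply: (@le_trans _ _ `|B * `|phi_term q a b c z n| |); last by near: n.
by rewrite (ger0_norm (mulr_ge0 B0 (normr_ge0 _))) ler_piMr ?mulr_ge0//
  exprn_ile1// ltW.
Unshelve. all: by end_near. Qed.

(** The contiguous relation iterated [m] times. It compares partial sums, because convergence of the
    series is still to be proved, and is cross-multiplied to avoid dividing by [qpoch q z m]. *)
Lemma phi_sum_iter {K : numFieldType} (q a b c z l : K) (m : nat) :
  `|q| < 1 -> (fun n => q ^+ n) @ \oo --> (0 : K) ->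
  (forall n, qpoch q c n != 0) -> qpoch q c @ \oo --> l -> l != 0 ->
  c = z * a * b -> phi_term q a b c z @ \oo --> (0 : K) ->
  (fun n => qpoch q c m * qpoch q z m * series (phi_term q a b c z) n
    - qpoch q (z * a) m * qpoch q (z * b) m
      * series (phi_term q a b (c * q ^+ m) (z * q ^+ m)) n) @ \oo --> (0 : K).
Proof.
move=> q1 qn0 c0 cl l0 cE t0; elim: m => [|m IH].
  rewrite (_ : (fun n => _) = fun=> 0); first exact: cvg_cst.
  by apply/funext => n; rewrite /qpoch !big_ord0 !expr0 !mulr1 subrr.
set D := (X in X @ \oo --> _) in IH.
set t := phi_term q a b (c * q ^+ m) (z * q ^+ m).
(* The difference at [m.+1] is a constant multiple of the one at [m], minus the boundary term of one
   more contiguous step; both tend to 0. *)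
rewrite (_ : (fun n => _) = fun n => (1 - c * q ^+ m) * (1 - z * q ^+ m) * D n
  - qpoch q (z * a) m * qpoch q (z * b) m
    * ((1 - c * q ^+ m) * (1 - q ^+ n) * t n)).
  rewrite -[X in _ --> X](_ : (1 - c * q ^+ m) * (1 - z * q ^+ m) * 0
    - qpoch q (z * a) m * qpoch q (z * b) m
      * ((1 - c * q ^+ m) * (1 - 0) * 0) = 0 :> K); last by ring.
  apply: cvgB; first by apply: cvgM => //; exact: cvg_cst.
  apply: cvgM; first exact: cvg_cst.
  apply: cvgM; last exact: (phi_term_shift_cvg0 q a b c z l m).
  apply: cvgM; first exact: cvg_cst.
  by apply: cvgB => //; exact: cvg_cst.
apply/funext => n; rewrite /D /t /series/=.
have cmE : c * q ^+ m = z * q ^+ m * a * b by rewrite cE; ring.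
have := phi_sum_contiguous q a b _ _ n q1 (qpoch_shift_neq0 _ _ m c0) cmE.
rewrite -!mulrA -!exprSr => /(congr1 -%R); rewrite opprK => <-.
rewrite !qpochS; ring.
Qed.

Lemma phi_term0 {K : numFieldType} (q a b c z : K) : phi_term q a b c z 0 = 1.
Proof. by rewrite /phi_term /qpoch !big_ord0 expr0 !mulr1 divr1. Qed.

(** The term of index 0 is 1, and the shift makes the others geometrically small, uniformly in [n].
    Taking [n.+1] terms keeps the leading 1; a shift of at least one gives the decay in the
    index. *)
Lemma phi_sum_shift_dist {K : numFieldType} (q a b c z l : K) :
  `|q| < 1 -> (forall n, qpoch q c n != 0) ->
  qpoch q c @ \oo --> l -> l != 0 -> phi_term q a b c z @ \oo --> (0 : K) ->
  exists2 W : K, 0 <= W & forall m n,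
    `|series (phi_term q a b (c * q ^+ m.+1) (z * q ^+ m.+1)) n.+1 - 1|
    <= W * `|q| ^+ m.+1.
Proof.
move=> q1 c0 cl l0 t0.
have [B B0 tB] := phi_term_shift_bound q a b c z l q1 c0 cl l0.
have [T tT] : exists T, forall n, `|phi_term q a b c z n| <= T.
  exact: cvg_norm_le t0.
have T0 : 0 <= T := le_trans (normr_ge0 _) (tT 0%N).
have q1' : 0 < 1 - `|q| by rewrite subr_gt0.
exists (B * T / (1 - `|q|)) => [|m n]; first by rewrite !mulr_ge0// invr_ge0 ltW.
rewrite /series/= big_nat_recl//= phi_term0 addrC addKr.
apply: le_trans (ler_norm_sum _ _ _) _.
apply: (@le_trans _ _ (\sum_(0 <= i < n) B * T * `|q| ^+ m.+1 * `|q| ^+ i)).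
  apply: ler_sum => i _; apply: le_trans (tB _ _) _.
  rewrite -[leRHS]mulrA ler_pM ?mulr_ge0 ?exprn_ge0//.
    by rewrite ler_wpM2l.
  (* The surplus exponent [i * m] is discarded, leaving a geometric sum over [i] times
     [|q|^(m+1)]. *)
  rewrite -exprD (_ : i.+1 * m.+1 = (m.+1 + i) + i * m)%N; last by lia.
  by rewrite (exprD _ (m.+1 + i)%N) ler_piMr ?exprn_ge0// exprn_ile1// ltW.
rewrite -mulr_sumr [leRHS]mulrAC ler_wpM2l//.
  by rewrite !mulr_ge0// exprn_ge0.
rewrite -[leRHS]mul1r ler_pdivlMr// big_mkord mulrC -opprB mulNr -subrX1 opprB.
by rewrite gerBl exprn_ge0.
Qed.

(** With [c = z a b], the products [z a] and [z b] play the roles of [c/b] and [c/a]. First a shift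
    [m] is fixed for which the finite products are near their limit and the shifted series is near
    1; then [n] grows. *)
Lemma q_gauss {K : numFieldType} (q a b c z cl zl al bl : K) :
  `|q| < 1 -> (fun n => q ^+ n) @ \oo --> (0 : K) ->
  (forall n, qpoch q c n != 0) -> c = z * a * b ->
  qpoch q c @ \oo --> cl -> cl != 0 -> qpoch q z @ \oo --> zl -> zl != 0 ->
  qpoch q (z * a) @ \oo --> al -> qpoch q (z * b) @ \oo --> bl ->
  phi_term q a b c z @ \oo --> (0 : K) ->
  series (phi_term q a b c z) @ \oo --> (al * bl) / (cl * zl).
Proof.
move=> q1 qn0 c0 cE ccl cl0 zzl zl0 aal bbl t0.
have [W W0 SW] := phi_sum_shift_dist q a b c z cl q1 c0 ccl cl0 t0.
pose X m := qpoch q (z * a) m * qpoch q (z * b) m / (qpoch q c m * qpoch q z m).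
have Xl : X @ \oo --> (al * bl) / (cl * zl).
  apply: cvgM; first exact: cvgM.
  by apply: cvgV; [rewrite mulf_neq0|exact: cvgM].
have XW : (fun m => X m * (W * q ^+ m)) @ \oo --> (0 : K).
  rewrite -(mulr0 (al * bl / (cl * zl))) -[X in _ * X](mulr0 W).
  by apply: cvgM => //; apply: cvgM => //; exact: cvg_cst.
apply/cvgrPdist_le => e e0.
have e30 : 0 < e / 3 by rewrite divr_gt0.
have /cvgrPdist_le/(_ _ e30) Xe := Xl.
have /cvgr0Pnorm_le/(_ _ e30) We := XW.
have z0 : \forall m \near \oo, qpoch q z m != 0 by exact: (cvgr_neq0 _ zzl zl0).
have [m [Xm Wm zm]] : exists m, [/\ `|al * bl / (cl * zl) - X m.+1| <= e / 3,
    `|X m.+1 * (W * q ^+ m.+1)| <= e / 3 & qpoch q z m.+1 != 0].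
  have : \forall m \near \oo, [/\ `|al * bl / (cl * zl) - X m| <= e / 3,
    `|X m * (W * q ^+ m)| <= e / 3 & qpoch q z m != 0].
    by near=> m; split; near: m.
  by move=> [N _ HN]; exists N; exact: HN (leqnSn N).
set P := qpoch q c m.+1 * qpoch q z m.+1.
have P0 : P != 0 by rewrite mulf_neq0.
have DP : (fun n => (P * series (phi_term q a b c z) n
    - qpoch q (z * a) m.+1 * qpoch q (z * b) m.+1
      * series (phi_term q a b (c * q ^+ m.+1) (z * q ^+ m.+1)) n) / P)
    @ \oo --> (0 : K).
  rewrite -(mul0r P^-1); apply: cvgM; last exact: cvg_cst.
  exact: (phi_sum_iter _ _ _ _ _ cl).
have /cvgr0Pnorm_le/(_ _ e30) De := DP.
have n_gt0 : \forall n \near \oo, (0 < n)%N by exists 1%N.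
near=> n.
have n0 : (0 < n)%N by near: n.
have Dn : `|(P * series (phi_term q a b c z) n
    - qpoch q (z * a) m.+1 * qpoch q (z * b) m.+1
      * series (phi_term q a b (c * q ^+ m.+1) (z * q ^+ m.+1)) n) / P| <= e / 3.
  by near: n.
move: Dn; set S := series _ n.
set S' := series (phi_term q a b (c * q ^+ m.+1) (z * q ^+ m.+1)) n => Dn.
(* Three errors of at most [e / 3]: finite against infinite products, the iterated relation, and the
   distance of the shifted series from 1. *)
have -> : al * bl / (cl * zl) - S = (al * bl / (cl * zl) - X m.+1)
    - (P * S - qpoch q (z * a) m.+1 * qpoch q (z * b) m.+1 * S') / P
    - X m.+1 * (S' - 1).
  by rewrite /X -/P; move: (al * bl / _) => L; field.
have -> : e = e / 3 + e / 3 + e / 3 by field.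
apply: le_trans (ler_normB _ _) _; apply: lerD.
  apply: le_trans (ler_normB _ _) _; exact: lerD.
apply: le_trans Wm; rewrite !normrM ler_wpM2l// normrX (ger0_norm W0) /S'.
by rewrite -(prednK n0); exact: SW.
Unshelve. all: by end_near. Qed.

(** * Unordered sums: single terms, enumeration, summation by rows *)

Lemma cvg_partial_sumP {I : choiceType} {K : numFieldType} (f : I -> K) (S : K) :
  summability.partial_sum f @ summability.totally --> S <->
  (forall e : K, 0 < e -> exists s0 : seq I, forall s : seq I,
     uniq s -> {subset s0 <= s} -> `|S - \sum_(i <- s) f i| <= e).
Proof.
have FF := @summability.totally_filter I.
split=> [/cvgrPdist_le fS e e0|H].
  have [A _ HA] := fS _ e0; exists (enum_fset A) => s us As.
  have /HA /= : [set B | (A `<=` B)%fset] [fset x in s]%fset.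
    by apply/fsubsetP => x xA; rewrite in_fset/=; exact: As.
  rewrite /summability.partial_sum -(big_seq_fsetE _ _ xpredT f).
  by rewrite (perm_big s)//; apply: uniq_perm => // x; rewrite in_fset.
apply/cvgrPdist_le => e /H[s0 Hs0].
exists [fset x in s0]%fset => // B /= /fsubsetP s0B.
rewrite /summability.partial_sum -(big_seq_fsetE _ _ xpredT f).
by apply: Hs0 => // x xs0; apply: s0B; rewrite in_fset.
Qed.

(** Adding one index outside a sufficiently large finite set changes the partial sum by that term,
    and both sums are within [e / 2] of [S]. *)
Lemma partial_sum_term_cvg0 {I : choiceType} {K : numFieldType} (f : I -> K)
    (S : K) (h : nat -> I) :
  summability.partial_sum f @ summability.totally --> S ->
  injective h -> (fun n => f (h n)) @ \oo --> (0 : K).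
Proof.
move=> /cvg_partial_sumP fS hI; apply/cvgr0Pnorm_le => e e0.
have e20 : 0 < e / 2 by rewrite divr_gt0.
have [s0 Hs0] := fS _ e20.
(* An injective [h] takes each value at most once, so it eventually leaves a finite set. *)
have hs0 : \forall n \near \oo, h n \notin undup s0.
  elim: (undup s0) => [|x s IH]; first by near=> n.
  have hx : \forall n \near \oo, h n != x.
    have [[m hm]|nx] := pselect (exists m, h m = x).
      exists m.+1 => // n /= mn; apply: contraTneq mn => hn.
      by rewrite (hI n m) ?ltnn// hn.
    by near=> n; apply/eqP => hn; apply: nx; exists n.
  by near=> n; rewrite inE negb_or; apply/andP; split; near: n.
near=> n.
have hn : h n \notin undup s0 by near: n.
have -> : f (h n) = (S - \sum_(i <- undup s0) f i)
    - (S - \sum_(i <- h n :: undup s0) f i).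
  by rewrite big_cons; ring.
rewrite (splitr e); apply: le_trans (ler_normB _ _) _; apply: lerD; apply: Hs0.
- exact: undup_uniq.
- by move=> x; rewrite mem_undup.
- by rewrite /= hn undup_uniq.
- by move=> x; rewrite inE mem_undup => ->; rewrite orbT.
Unshelve. all: by end_near. Qed.

(** Long initial segments of the enumeration contain any given finite set of indices. *)
Lemma partial_sum_series {I : choiceType} {K : numFieldType} (f : I -> K)
    (S : K) (h : nat -> I) (d : I -> nat) :
  summability.partial_sum f @ summability.totally --> S ->
  cancel h d -> cancel d h -> series (f \o h) @ \oo --> S.
Proof.
move=> /cvg_partial_sumP fS hK dK; apply/cvgrPdist_le => e /fS[s0 Hs0].
exists (\max_(i <- s0) d i).+1 => // n /= sn.
have := Hs0 [seq h t | t <- index_iota 0 n]; rewrite big_map; apply.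
  by rewrite map_inj_uniq ?iota_uniq//; exact: can_inj hK.
move=> x xs0; rewrite -(dK x) map_f// mem_index_iota/=.
by apply: leq_trans sn; rewrite ltnS; exact: leq_bigmax_seq.
Qed.

(** A Fubini argument: finitely many rows cut at a large [n] form a finite set containing [s0], and
    in the finite sum of rows each cut row is near its limit. *)
Lemma partial_sum_rows {I J : choiceType} {K : numFieldType} (f : I -> K)
    (r : J -> K) (S : K) (h : nat -> J -> I) (d : I -> nat * J) :
  summability.partial_sum f @ summability.totally --> S ->
  (forall t j, d (h t j) = (t, j)) -> (forall i, h (d i).1 (d i).2 = i) ->
  (forall j, series (fun t => f (h t j)) @ \oo --> r j) ->
  summability.partial_sum r @ summability.totally --> S.
Proof.
move=> /cvg_partial_sumP fS hK dK fr; apply/cvg_partial_sumP => e e0.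
have e20 : 0 < e / 2 by rewrite divr_gt0.
have [s0 Hs0] := fS _ e20; exists [seq (d i).2 | i <- s0] => s us s0s.
have rs : (fun n => \sum_(j <- s) series (fun t => f (h t j)) n)
    @ \oo --> \sum_(j <- s) r j.
  by apply: cvg_big => [|j _]; [exact: add_continuous|exact: fr].
have /cvgrPdist_le/(_ _ e20) rse := rs.
have ns0 : \forall n \near \oo, (\max_(i <- s0) (d i).1 < n)%N.
  by exists (\max_(i <- s0) (d i).1).+1.
have [n [nr n0]] : exists n,
    `|\sum_(j <- s) r j - \sum_(j <- s) series (fun t => f (h t j)) n| <= e / 2
    /\ (\max_(i <- s0) (d i).1 < n)%N.
  suff : \forall n \near \oo, `|\sum_(j <- s) r j
    - \sum_(j <- s) series (fun t => f (h t j)) n| <= e / 2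
    /\ (\max_(i <- s0) (d i).1 < n)%N by exact: filter_ex.
  by near=> n; split; near: n.
have Sn : `|S - \sum_(j <- s) series (fun t => f (h t j)) n| <= e / 2.
  have -> : \sum_(j <- s) series (fun t => f (h t j)) n
      = \sum_(i <- [seq h t j | j <- s, t <- index_iota 0 n]) f i.
    by rewrite big_allpairs_dep.
  apply: Hs0.
    rewrite allpairs_uniq ?iota_uniq// => -[j t] [j' t'] _ _ /= hjt.
    by have := hK t j; rewrite hjt hK => -[-> ->].
  move=> i is0; apply/allpairsP; exists ((d i).2, (d i).1) => /=; split.
  - by apply: s0s; exact: map_f.
  - by rewrite mem_index_iota/=; apply: leq_ltn_trans n0; exact: (leq_bigmax_seq i).
  - by rewrite dK.
set Sg := \sum_(j <- s) series _ _ in nr Sn.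
have -> : S - \sum_(j <- s) r j = (S - Sg) - (\sum_(j <- s) r j - Sg) by ring.
by rewrite (splitr e); apply: le_trans (ler_normB _ _) _; exact: lerD.
Unshelve. all: by end_near. Qed.

(** * Splitting a nonincreasing tuple into its first gap and its tail *)

Lemma sorted_cons_addn (k : nat) (t : nat) (m : noninc_tuple k) :
  sorted geq (val [tuple of (mpart m 0 + t)%N :: val m]).
Proof.
case: m => -[[|n s] sz] //= ms; rewrite /mpart/= ms andbT.
exact: leq_addr.
Qed.

(** Here [t] is the gap m_1 - m_2 rather than the new entry, so that the pair [(t, m)] ranges over a
    full product and rows are indexed by all of [nat]. *)
Definition noninc_cons {k : nat} (t : nat) (m : noninc_tuple k) :
  noninc_tuple k.+1 :=
  exist (fun m : k.+2.-tuple nat => is_true (sorted geq m)) _ (sorted_cons_addn k t m).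

Lemma sorted_behead_tuple (k : nat) (m : noninc_tuple k.+1) :
  sorted geq (val [tuple of behead (val m)]).
Proof.
by case: m => -[[|n [|n' s]] sz] //= /andP[].
Qed.

Definition noninc_uncons {k : nat} (m : noninc_tuple k.+1) :
  nat * noninc_tuple k :=
  ((mpart m 0 - mpart m 1)%N,
   exist (fun m : k.+1.-tuple nat => is_true (sorted geq m))
     _ (sorted_behead_tuple k m)).

Lemma noninc_consK {k : nat} (t : nat) (m : noninc_tuple k) :
  noninc_uncons (noninc_cons t m) = (t, m).
Proof.
rewrite /noninc_uncons; congr (_, _).
  by rewrite /mpart/= addKn.
by apply/val_inj/val_inj.
Qed.

Lemma noninc_unconsK {k : nat} (m : noninc_tuple k.+1) :
  noninc_cons (noninc_uncons m).1 (noninc_uncons m).2 = m.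
Proof.
apply/val_inj/val_inj; rewrite /mpart/=.
case: m => -[[|n [|n' s]] sz] //= ms; have /andP[nn' _] := ms.
by rewrite /mpart/= subnKC.
Qed.

Definition noninc_const (n : nat) : noninc_tuple 0 :=
  exist (fun m : 1.-tuple nat => is_true (sorted geq m)) [tuple n] isT.

Lemma noninc_const_mpart (m : noninc_tuple 0) : noninc_const (mpart m 0) = m.
Proof.
by apply/val_inj/val_inj; case: m => -[[|n [|n' s]] sz].
Qed.

(** * Summation over the first entry and induction on [k] *)

Lemma multisum_term_cons {K : numFieldType} {k : nat} (q : K)
    (a b c : 'I_k.+1 -> K) (g : nat -> K) (t : nat) (m : noninc_tuple k) :
  let n := mpart m 0 in
  qpoch q (a ord0) n != 0 ->
  multisum_term q a b c g (noninc_cons t m)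
  = qpoch q (c ord0 / b ord0) n / qpoch q (c ord0) n
    * phi_term q (a ord0 * q ^+ n) (b ord0) (c ord0 * q ^+ n)
        (c ord0 / (a ord0 * b ord0)) t
    * multisum_term q (a \o lift ord0) (b \o lift ord0) (c \o lift ord0) g m.
Proof.
move=> n an0; rewrite /multisum_term big_ord_recl [RHS]mulrA; congr (_ * _ * _).
rewrite /phi_term.
have -> : mpart (noninc_cons t m) (ord0 : 'I_k.+1) = (n + t)%N by [].
have -> : mpart (noninc_cons t m) (ord0 : 'I_k.+1).+1 = n by [].
(* The factor [(a)_n / (a)_n = 1] is inserted on the right to match the left, where [(a)_(n+t)] has
   been split. *)
rewrite addKn !qpochD !invfM -[RHS]mul1r -(divff an0); ring.
Qed.

Lemma qpoch_shift_cvg {K : numFieldType} (q x : K) (n : nat) :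
  cvgn (qpoch q x) -> qpoch q x n != 0 ->
  qpoch q (x * q ^+ n) @ \oo --> qpoch_inf q x / qpoch q x n.
Proof.
move=> xc xn0; rewrite (_ : qpoch q (x * q ^+ n)
    = fun m => qpoch q x (m + n) / qpoch q x n); last first.
  by apply/funext => m; rewrite addnC qpochD [RHS]mulrC mulKf.
apply: cvgM; last exact: cvg_cst.
by rewrite (cvg_shiftn n (qpoch q x) _).
Qed.

Lemma qpoch_inf_eq0 {K : numFieldType} (q x : K) (n : nat) :
  qpoch q x n = 0 -> qpoch_inf q x = 0.
Proof.
move=> xn0; apply: cvg_lim; first exact: norm_hausdorff.
rewrite -(cvg_shiftn n) (_ : (fun m => _) = fun=> 0); first exact: cvg_cst.
by apply/funext => m; rewrite addnC qpochD xn0 mul0r.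
Qed.

(** q-Gauss with [a] and [c] shifted by [q^n] yields [(c)_n / (c/b)_n] times the unshifted constant;
    this cancels the prefactor [w], so the constant is the same for every row. *)
Lemma multisum_row {K : numFieldType} {k : nat} (q : K)
    (a b c : 'I_k.+1 -> K) (g : nat -> K) (m : noninc_tuple k) :
  `|q| < 1 -> (fun n => q ^+ n) @ \oo --> (0 : K) ->
  (forall x, cvgn (qpoch q x)) ->
  a ord0 != 0 -> b ord0 != 0 -> (forall n, qpoch q (a ord0) n != 0) ->
  (forall n, qpoch q (c ord0) n != 0) -> qpoch_inf q (c ord0) != 0 ->
  qpoch_inf q (c ord0 / (a ord0 * b ord0)) != 0 ->
  (fun t => multisum_term q a b c g (noninc_cons t m)) @ \oo --> (0 : K) ->
  series (fun t => multisum_term q a b c g (noninc_cons t m)) @ \oo -->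
    qpoch_inf q (c ord0 / a ord0) * qpoch_inf q (c ord0 / b ord0)
      / (qpoch_inf q (c ord0) * qpoch_inf q (c ord0 / (a ord0 * b ord0)))
    * multisum_term q (a \o lift ord0) (b \o lift ord0) (c \o lift ord0) g m.
Proof.
move=> q1 qn0 qcvg a0 b0 an0 cn0 cl0 zl0.
set z := c ord0 / (a ord0 * b ord0); set T := multisum_term _ _ _ _ _ m.
set n := mpart m 0.
set phi := phi_term q (a ord0 * q ^+ n) (b ord0) (c ord0 * q ^+ n) z.
set w := qpoch q (c ord0 / b ord0) n / qpoch q (c ord0) n.
rewrite (_ : (fun t => _) = fun t => w * phi t * T); last first.
  by apply/funext => t; exact: multisum_term_cons.
have seriesE : series (fun t => w * phi t * T) = fun N => w * T * series phi N.
  by apply/funext => N; rewrite /series/= mulr_sumr; apply: eq_bigr => t _;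
    rewrite mulrAC.
rewrite seriesE => f0.
(* If [w * T = 0], decay of the row says nothing about [phi]. The row is then 0, and so is the
   claimed sum: either [T = 0], or [(c/b)_n = 0] and hence the infinite product vanishes. *)
have [wT0|wT0] := eqVneq (w * T) 0.
  rewrite (_ : (fun N => _) = fun=> 0); last by apply/funext => N; rewrite wT0 mul0r.
  rewrite [X in _ --> X](_ : _ = 0); first exact: cvg_cst.
  move/eqP: wT0; rewrite mulf_eq0 => /orP[|/eqP->]; last by rewrite mulr0.
  rewrite mulf_eq0 invr_eq0 (negPf (cn0 n)) orbF => /eqP/qpoch_inf_eq0 ->.
  by rewrite mulr0 !mul0r.
have phi0 : phi @ \oo --> (0 : K).
  rewrite (_ : phi = fun t => (w * T)^-1 * (w * phi t * T)); last first.
    by apply/funext => t; rewrite (mulrAC w) mulKf.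
  by rewrite -(mulr0 (w * T)^-1); apply: cvgM => //; exact: cvg_cst.
have [w0 T0] : w != 0 /\ T != 0 by move: wT0; rewrite mulf_eq0 negb_or => /andP[].
have cbn0 : qpoch q (c ord0 / b ord0) n != 0.
  by move: w0; rewrite mulf_eq0 negb_or => /andP[].
have zaE : z * (a ord0 * q ^+ n) = c ord0 / b ord0 * q ^+ n.
  by rewrite /z; field; rewrite a0 b0.
have zbE : z * b ord0 = c ord0 / a ord0 by rewrite /z; field; rewrite a0 b0.
have cE : c ord0 * q ^+ n = z * (a ord0 * q ^+ n) * b ord0 by rewrite zaE; field.
have zc : qpoch q z @ \oo --> qpoch_inf q z by exact: qcvg.
have ac : qpoch q (z * (a ord0 * q ^+ n)) @ \oo -->
    qpoch_inf q (c ord0 / b ord0) / qpoch q (c ord0 / b ord0) n.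
  by rewrite zaE; exact: qpoch_shift_cvg.
have bc : qpoch q (z * b ord0) @ \oo --> qpoch_inf q (c ord0 / a ord0).
  by rewrite zbE; exact: qcvg.
have cc := qpoch_shift_cvg q (c ord0) n (qcvg _) (cn0 n).
have ccl0 : qpoch_inf q (c ord0) / qpoch q (c ord0) n != 0.
  by rewrite mulf_neq0// invr_neq0.
have := q_gauss q _ _ _ z _ _ _ _ q1 qn0 (qpoch_shift_neq0 _ _ n cn0) cE
  cc ccl0 zc zl0 ac bc phi0.
move=> S.
rewrite [X in _ --> X](_ : _ = w * T * (qpoch_inf q (c ord0 / b ord0)
    / qpoch q (c ord0 / b ord0) n * qpoch_inf q (c ord0 / a ord0)
    / (qpoch_inf q (c ord0) / qpoch q (c ord0) n * qpoch_inf q z))).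
  by apply: cvgM => //; exact: cvg_cst.
rewrite /w; field.
by rewrite cl0 zl0 cbn0 cn0.
Qed.

(** The limit [S] is arbitrary so that the induction hypothesis applies to [C^-1 * S]; at [k = 0]
    the multiple series is the series of [g]. *)
Lemma multisum_eq {K : numFieldType} {k : nat} (q : K)
    (a b c : 'I_k -> K) (g : nat -> K) (S : K) :
  `|q| < 1 -> (fun n => q ^+ n) @ \oo --> (0 : K) ->
  (forall x, cvgn (qpoch q x)) ->
  (forall j, a j != 0) -> (forall j, b j != 0) ->
  (forall j n, qpoch q (a j) n != 0) -> (forall j n, qpoch q (c j) n != 0) ->
  (forall j, qpoch_inf q (c j) != 0) ->
  (forall j, qpoch_inf q (c j / (a j * b j)) != 0) ->
  summability.partial_sum (multisum_term q a b c g) @ summability.totally --> S ->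
  S = (\prod_(j < k) ((qpoch_inf q (c j / a j) * qpoch_inf q (c j / b j))
        / (qpoch_inf q (c j) * qpoch_inf q (c j / (a j * b j)))))
      * limn (series g).
Proof.
move=> q1 qn0 qcvg; elim: k a b c S => [|k IH] a b c S a0 b0 an0 cn0 cl0 zl0 fS.
  rewrite big_ord0 mul1r; apply/esym/cvg_lim; first exact: norm_hausdorff.
  have := partial_sum_series _ _ noninc_const (fun m => mpart m 0) fS
    (fun n => erefl) noninc_const_mpart.
  by under [X in series X]funext => n do rewrite /= /multisum_term big_ord0 mul1r.
rewrite big_ord_recl -mulrA; set C := (X in X * _).
have rS : summability.partial_sum (fun m => C * multisum_term q (a \o lift ord0)
    (b \o lift ord0) (c \o lift ord0) g m) @ summability.totally --> S.
  apply: (partial_sum_rows _ _ _ noninc_cons noninc_uncons fS noninc_consK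
    noninc_unconsK) => m.
  apply: multisum_row => //; apply: partial_sum_term_cvg0 fS _ => t t' tt'.
  by have := noninc_consK t m; rewrite tt' noninc_consK => -[].
have TF := @summability.totally_filter (noninc_tuple k).
have CE : summability.partial_sum (fun m => C * multisum_term q (a \o lift ord0)
    (b \o lift ord0) (c \o lift ord0) g m)
    = fun A => C * summability.partial_sum (multisum_term q (a \o lift ord0)
    (b \o lift ord0) (c \o lift ord0) g) A.
  by apply/funext => A; rewrite /summability.partial_sum mulr_sumr.
rewrite CE in rS.
(* For [C = 0] the row sums all vanish and [S = 0]. Otherwise division by [C] transfers convergence
   to the inner multiple series. *)
have [C0|C0] := eqVneq C 0.
  rewrite C0 mul0r; apply: (cvg_unique _ rS); first exact: norm_hausdorff.
  by under [X in X @ _]funext => A do rewrite C0 mul0r; exact: cvg_cst.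
have {}rS : summability.partial_sum (multisum_term q (a \o lift ord0)
    (b \o lift ord0) (c \o lift ord0) g) @ summability.totally --> C^-1 * S.
  under [X in X @ _]funext => A do rewrite -[summability.partial_sum _ _](mulKf C0).
  by apply: cvgM => //; exact: cvg_cst.
by rewrite -[LHS](mulVKf C0); congr (_ * _); apply: IH rS => //= j.
Qed.

Theorem theorem2 (R : realType) (q : R[i]) (k : nat)
    (a b c : 'I_k -> R[i]) (g : nat -> R[i])
    (hq : `|q| < 1) (hk : (1 <= k)%N)
    (ha0 : forall j, a j != 0) (hb0 : forall j, b j != 0)
    (ha : forall j n, qpoch q (a j) n != 0)
    (hc : forall j n, qpoch q (c j) n != 0)
    (hcoo : forall j, qpoch_inf q (c j) != 0)
    (hzoo : forall j, qpoch_inf q (c j / (a j * b j)) != 0)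
    (hL : multiseries_cvg (multisum_term q a b c g))
    (hR : cvgn (series (g : nat -> R[i]^o))) :
  multiseries_sum (multisum_term q a b c g)
  = (\prod_(j < k)
       ((qpoch_inf q (c j / a j) * qpoch_inf q (c j / b j))
        / (qpoch_inf q (c j) * qpoch_inf q (c j / (a j * b j)))))
    * limn (series (g : nat -> R[i]^o)).
Proof.
(* Over [R[i]], [|q| < 1] supplies the analytic inputs: decay of [q^n] and convergence of every
   q-product. The limit [S] is the one contained in [hL]. *)
exact: (@multisum_eq R[i] k q a b c g _ hq (cvg_complex_expr q hq)
  (fun x => is_cvg_qpoch q x hq) ha0 hb0 ha hc hcoo hzoo hL).
Qed.
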